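(* Let $p_n(x)$ be polynomials satisfying $p_{n+1}(x)=(Ax-b_n)p_n(x)-\lambda_np_{n-1}(x)$ for $n\ge0$, where $p_{-1}(x)=0$ and $p_0(x)=1$. If $b_k$ and $\frac{\lambda_k}{1-q^k}$ are polynomials in $q^k$ of degree $r$ and $s$, respectively, which are independent of $y$, then the polynomials $P^{(1)}_n(x,y)$ in $x$ defined by $$\sum_{n=0}^\infty P^{(1)}_n(x,y)\frac{t^n}{(q)_n}=(yt)_\infty\sum_{n=0}^\infty p_n(x)\frac{t^n}{(q)_n}$$ satisfy a $d$-term recurrence relation for $d=\max(r+2,s+3)$.
   Context: $q$ is a fixed number with $0<|q|<1$; $(z)_n=\prod_{i=0}^{n-1}(1-zq^i)$ and $(z)_\infty=\prod_{i\ge0}(1-zq^i)$; generating functions are formal power series in $t$. $A$ is a real number and $\{b_n\}$, $\{\lambda_n\}$ are sequences of numbers. ''$b_k$ (resp. $\lambda_k/(1-q^k)$) is a polynomial in $q^k$ of degree $r$ (resp. $s$)'' means that there are constants $c_j$ (resp. $d_j$), independent of $k$, with $b_k=\sum_{j=0}^r c_j(q^k)^j$ (resp. $\lambda_k/(1-q^k)=\sum_{j=0}^s d_j(q^k)^j$) and nonzero leading coefficient; ''independent of $y$'' means that these constants do not depend on $y$. The zero polynomial has degree $-\infty$. Polynomials $P_n(x)$ (here $P_n(x)=P^{(1)}_n(x,y)$ with $y$ a parameter) satisfy a $d$-term recurrence relation if there exist a real number $A$ and sequences $\{b_n^{(0)}\}_{n\ge0},\{b_n^{(1)}\}_{n\ge1},\dots,\{b_n^{(d-2)}\}_{n\ge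 d-2}$, not depending on $x$ (but possibly depending on $y$ and $q$), such that for all $n\ge0$ $$P_{n+1}(x)=(Ax-b_n^{(0)})P_n(x)-b_n^{(1)}P_{n-1}(x)-\dots-b_n^{(d-2)}P_{n-d+2}(x),$$ where $P_i(x)=0$ for $i<0$. *)

(* Defs.v *)
From HB Require Import structures.
From mathcomp Require Export all_boot all_order all_algebra complex.
From mathcomp Require Export all_classical all_reals all_analysis.
Export numFieldNormedType.Exports.

Set Implicit Arguments.
Unset Strict Implicit.
Unset Printing Implicit Defensive.

Import Order.TTheory GRing.Theory Num.Theory.
Local Open Scope classical_set_scope.
Local Open Scope ring_scope.

(* The q-shifted factorial (z)_n to the base q. *)
Definition qpoch (S : comNzRingType) (q z : S) (n : nat) : S :=
  \prod_(i < n) (1 - z * q ^+ i).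

(* A formal power series in t is the sequence of its coefficients. *)
Definition fps_mul (S : comNzRingType) (f g : nat -> S) : nat -> S :=
  fun n => \sum_(i < n.+1) f i * g (n - i)%N.

(* The formal power series (y t)_oo: each coefficient is the limit of the
   corresponding coefficients of the partial products (y t)_N, which are
   polynomials in t. *)
Definition qpoch_inf (K : numFieldType) (q y : K) : nat -> K :=
  fun k => lim ((fun N => (qpoch q%:P (y *: 'X) N)`_k) @ \oo).

(* \sum_n u_n(x) t^n / (q)_n. *)
Definition qgenfun (K : numFieldType) (q : K) (u : nat -> {poly K}) :
    nat -> {poly K} :=
  fun n => (qpoch q q n)^-1 *: u n.

(* u_(n-j), with the convention u_i = 0 for i < 0. *)
Definition back (K : numFieldType) (u : nat -> {poly K}) (n j : nat) :
    {poly K} :=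
  if (j <= n)%N then u (n - j)%N else 0.

(* Degree of a polynomial, with value -oo at 0; size c is 1 + the degree
   when c != 0. *)
Definition degree (K : numFieldType) (c : {poly K}) : \bar int :=
  if c == 0 then -oo%E else ((size c).-1%:Z)%:E.

(* The sequence (u_k), k >= m, is a polynomial in q^k of degree r. *)
Definition poly_in_qpow (K : numFieldType) (q : K) (m : nat) (u : nat -> K)
    (r : \bar int) : Prop :=
  exists2 c : {poly K}, degree c = r &
    forall k, (m <= k)%N -> u k = c.[q ^+ k].

(* d-term recurrence relation for a family P y n of polynomials in x with
   parameter y. Only A is required to be real and independent of y; b y j n
   stands for b_n^(j), whose values for n < j are irrelevant. *)
Definition dterm_recurrence (K : numFieldType) (d : nat)
    (P : K -> nat -> {poly K}) : Prop :=
  (2 <= d)%N /\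
  exists2 A : K, A \is Num.real &
  exists b : K -> nat -> nat -> K, forall y n,
    P y n.+1 = (A *: 'X - (b y 0 n)%:P) * P y n
               - \sum_(1 <= j < d.-1) b y j n *: back (P y) n j.

(* Main.v *)
Require Import Defs.
From mathcomp Require Import ring zify.

(** Write G(t) = sum_n p_n t^n/(q)_n, E(t) = (y t)_oo and F(t) = E(t) G(t), so
    that F(t) = sum_n P_n t^n/(q)_n.  The recurrence of the p_n says that
    G(t) - G(q t) is t times a combination of x G(t), of the series G(q^j t)
    (from b) and of the series t G(q^j t) (from lambda).
    Everything rests on E(t) = (1 - y t) E(q t) ([qpoch_inf_step]), which gives
      E(t) G(q t) = (1 - y t) F(q t)
    for every G ([conv_dilate]).  It is used in two ways.

    - Iterated j times, it writes the coefficient of t^n in E(t) G(q^j t) as a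
      combination, with scalars depending on n, of the j + 1 coefficients
      F_n, ..., F_(n-j).  By linearity, E times the series with coefficients
      c(q^n) G_n involves deg c + 1 consecutive coefficients of F
      ([band_conv_horner]).
    - Subtracted from F = E G, it gives
      E(t) (G(t) - G(q t)) = F(t) - F(q t) + y t F(q t),
      so that E times the recurrence of the p_n is a recurrence for F.

    Hence (1 - q^(n+1)) F_(n+1) - A x F_n is a combination of F_n, ..., F_(n-r)
    (from b), F_(n-1), ..., F_(n-1-s) (from lambda, shifted by the factor t),
    and one more multiple of F_n ([conv_recurrence]).  Multiplication by (q)_n
    turns this into a recurrence for P_n with max (r, s + 1) + 2 terms. *)

Set Implicit Arguments.
Unset Strict Implicit.
Unset Printing Implicit Defensive.

Import Order.TTheory GRing.Theory Num.Theory.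
Local Open Scope ring_scope.
Local Open Scope complex_scope.

(** * The coefficients of (y t)_oo *)

(** With f_N(t) = (y t)_N, the product f_(N+1)(t) can be split off at either
    end: (1 - y t) f_N(q t) = f_N(t) (1 - y q^N t).  Comparing coefficients of
    t^(k+1) gives a two-term recurrence in k at fixed N, in which N appears
    only through q^N. *)
Lemma coef_qpoch_step (K : numFieldType) (q y : K) (N k : nat) :
  (1 - q ^+ k.+1) * (qpoch q%:P (y *: 'X) N)`_k.+1 =
  y * (q ^+ N - q ^+ k) * (qpoch q%:P (y *: 'X) N)`_k.
Proof.
set f := qpoch q%:P (y *: 'X) N.
have coefl (a : K) (g : {poly K}) :
  ((1 - a *: 'X) * g)`_k.+1 = g`_k.+1 - a * g`_k.
  by rewrite mulrBl mul1r -scalerAl coefB coefZ coefXM.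
have coefd (g : {poly K}) i : (g \Po (q *: 'X))`_i = q ^+ i * g`_i.
  rewrite comp_polyE coef_sum.
  rewrite (eq_bigr (fun j : 'I_(size g) =>
    if j == i :> nat then q ^+ i * g`_i else 0)).
    have [ltig|leig] := ltnP i (size g).
      by rewrite -big_mkcond (big_pred1 (Ordinal ltig)).
    by rewrite (nth_default 0 leig) mulr0 big1 // => j _; case: ifP.
  move=> j _; rewrite exprZn scalerA coefZ coefXn eq_sym.
  by case: eqP => [->|_]; rewrite ?mulr0 // mulr1 mulrC.
have fE M : qpoch q%:P (y *: 'X) M = \prod_(i < M) (1 - (y * q ^+ i) *: 'X).
  apply: eq_bigr => i _; congr (1 - _).
  by rewrite -polyC_exp mulrC mul_polyC scalerA mulrC.
have dil : (1 - y *: 'X) * (f \Po (q *: 'X)) = (1 - (y * q ^+ N) *: 'X) * f.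
  have -> : (1 - y *: 'X) * (f \Po (q *: 'X)) = qpoch q%:P (y *: 'X) N.+1.
    rewrite fE big_ord_recl expr0 mulr1; congr (_ * _).
    rewrite /f fE rmorph_prod; apply: eq_bigr => i _ /=.
    rewrite comp_polyB comp_polyC comp_polyZ comp_polyX scalerA.
    by rewrite exprS mulrA mulrAC.
  by rewrite /f !fE big_ord_recr /= mulrC.
have /(congr1 (fun g : {poly K} => g`_k.+1)) := dil.
rewrite !coefl !coefd => e.
move/eqP: e; rewrite eq_sym -subr_eq0 => /eqP e.
apply/eqP; rewrite -subr_eq0 -[X in _ == X]e; apply/eqP; ring.
Qed.

(** The functional equation E(t) = (1 - y t) E(q t) on coefficients.  The
    recurrence for the finite products also yields, by induction on k, that
    their coefficients converge, so that the limit may be taken in it. *)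
Lemma qpoch_inf_step (K : numFieldType) (q y : K) :
  (q ^+ n @[n --> \oo] --> 0)%classic ->
  (forall k, 1 - q ^+ k.+1 != 0) ->
  forall k, (1 - q ^+ k.+1) * qpoch_inf q y k.+1 =
    - (y * q ^+ k) * qpoch_inf q y k.
Proof.
move=> q0 q1 k.
pose c k N := (qpoch q%:P (y *: 'X) N)`_k.
have cS j N : c j.+1 N = (1 - q ^+ j.+1)^-1 * (y * (q ^+ N - q ^+ j)) * c j N.
  by rewrite -mulrA -coef_qpoch_step mulKf.
have cvS j l : (c j N @[N --> \oo] --> l)%classic ->
  (c j.+1 N @[N --> \oo] -->
     (1 - q ^+ j.+1)^-1 * (y * (0 - q ^+ j)) * l)%classic.
  move=> cl; rewrite (funext (cS j)).
  apply: cvgM => //; apply: cvgM; first exact: cvg_cst.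
  apply: cvgM; first exact: cvg_cst.
  by apply: cvgB => //; exact: cvg_cst.
have cv j : (c j N @[N --> \oo] --> qpoch_inf q y j)%classic.
  suff [l cl] : exists l : K, (c j N @[N --> \oo] --> l)%classic.
    by rewrite /qpoch_inf (cvg_lim _ cl) //; exact: norm_hausdorff.
  elim: j => [|j [l /cvS cl]]; last by eexists; exact: cl.
  exists 1; rewrite (_ : c 0%N = fun=> 1); first exact: cvg_cst.
  apply/funext => N; rewrite /c /qpoch; elim: N => [|N IH].
    by rewrite big_ord0 coefC.
  rewrite big_ord_recr /= mulrBr mulr1 -!scalerAl -scalerAr coefB coefZ.
  by rewrite mulrA mulrAC coefMX mulr0 subr0.
have := cvg_lim (@norm_hausdorff _ _) (cvS _ _ (cv k)).
rewrite (cvg_lim (@norm_hausdorff _ _) (cv k.+1)) => ->.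
by rewrite sub0r -!mulrA mulVKf // mulNr mulrN mulNr mulrA.
Qed.

(** The order on R[i] is only partial, so the geometric limit is obtained by
    comparing norms, which are real. *)
Lemma complex_cvg_expr (R : realType) (K := R[i] : numFieldType) (q : K) :
  `|q| < 1 -> (q ^+ n @[n --> \oo] --> 0)%classic.
Proof.
move=> q1; apply/cvgr0Pnorm_lt => e e0.
have reE (x : R[i]) : 0 <= x -> x = (complex.Re x)%:C.
  by move=> x0; rewrite RRe_real // ger0_real.
have qE := reE _ (normr_ge0 q); have eE := reE _ (ltW e0).
move: q1 e0; rewrite qE eE ltcR => q1; rewrite ltcR => e0.
have q0 : 0 <= complex.Re `|q| by rewrite -lecR -qE; exact: normr_ge0.
have := @cvg_expr R (complex.Re `|q|).
rewrite ger0_norm // => /(_ q1)/cvgr0Pnorm_lt/(_ _ e0).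
apply: filterS => n; rewrite ger0_norm ?exprn_ge0 //.
by rewrite -ltcR rmorphXn /= -qE -normrX -eE.
Qed.

(** * Multiplication by a solution of E(t) = (1 - y t) E(q t) *)

(** The scalar factor acts through the module structure, so that each
    coefficient of the product is visibly a linear combination of the G_k. *)
Definition conv (K : numFieldType) (E : nat -> K) (G : nat -> {poly K}) :
    nat -> {poly K} :=
  fun n => \sum_(i < n.+1) E i *: G (n - i)%N.

Lemma eq_conv (K : numFieldType) (E : nat -> K) (G H : nat -> {poly K}) :
  G =1 H -> conv E G =1 conv E H.
Proof. by move=> GH n; apply: eq_bigr => i _; rewrite GH. Qed.

Lemma convB (K : numFieldType) (E : nat -> K) (G H : nat -> {poly K}) n :
  conv E (fun k => G k - H k) n = conv E G n - conv E H n.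
Proof.
by rewrite /conv -sumrB; apply: eq_bigr => i _; rewrite scalerBr.
Qed.

Lemma convM (K : numFieldType) (E : nat -> K) (g : {poly K})
    (G : nat -> {poly K}) n :
  conv E (fun k => g * G k) n = g * conv E G n.
Proof. by rewrite /conv mulr_sumr; apply: eq_bigr => i _; rewrite scalerAr. Qed.

Lemma conv_sum (K : numFieldType) (E : nat -> K) (m : nat)
    (G : 'I_m -> nat -> {poly K}) n :
  conv E (fun k => \sum_(j < m) G j k) n = \sum_(j < m) conv E (G j) n.
Proof.
by rewrite /conv exchange_big; apply: eq_bigr => i _; rewrite scaler_sumr.
Qed.

Lemma conv_back (K : numFieldType) (E : nat -> K) (G : nat -> {poly K}) n :
  conv E (fun k => back G k 1) n = back (conv E G) n 1.
Proof.
case: n => [|n]; rewrite /back /conv /=.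
  by rewrite big_ord_recl big_ord0 scaler0 addr0.
rewrite big_ord_recr /= subnn scaler0 addr0 subn1 /=.
by apply: eq_bigr => i _; rewrite subSn 1?(leq_ord i) //= subn1.
Qed.

Lemma fps_mul_conv (K : numFieldType) (E : nat -> K) (G : nat -> {poly K}) n :
  fps_mul (fun k => (E k)%:P) G n = conv E G n.
Proof. by apply: eq_bigr => i _; rewrite mul_polyC. Qed.

(** The hypothesis on E says E(t) = (1 - y t) E(q t), whence
    E(t) G(q t) = (1 - y t) E(q t) G(q t): a dilation of G costs a dilation of
    the product E G and one backward shift. *)
Lemma conv_dilate (K : numFieldType) (q y : K) (E : nat -> K)
    (G : nat -> {poly K}) :
  (forall k, (1 - q ^+ k.+1) * E k.+1 = - (y * q ^+ k) * E k) ->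
  forall n, conv E (fun k => q ^+ k *: G k) n =
    q ^+ n *: conv E G n - (y * q ^+ n.-1) *: back (conv E G) n 1.
Proof.
move=> hE [|n]; rewrite /back /conv /=.
  by rewrite scaler0 subr0 !big_ord_recl !big_ord0 !addr0 subnn expr0 !scale1r.
rewrite subn1 /= !scaler_sumr.
rewrite [LHS]big_ord_recl [in RHS]big_ord_recl /= subn0 !scalerA.
rewrite [E 0%N * _]mulrC -addrA -sumrB; congr (_ + _).
apply: eq_bigr => i _; rewrite /bump /= add1n subSS !scalerA -scalerBl.
congr (_ *: _).
(* Both powers of q are made multiples of q^(n-i), the weight of G_(n-i). *)
have qn : q ^+ n = q ^+ (n - i) * q ^+ i by rewrite -exprD subnK ?leq_ord.
have qn1 : q ^+ n.+1 = q ^+ (n - i) * q ^+ i.+1.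
  by rewrite [in RHS]exprS mulrCA -qn exprS.
have -> : y * q ^+ n * E i = - (q ^+ (n - i) * ((1 - q ^+ i.+1) * E i.+1)).
  by rewrite hE qn; ring.
by rewrite qn1; ring.
Qed.

(** * Combinations of finitely many preceding terms *)

(** The coefficients a i n are left existential: only the number m of terms
    matters for the length of the final recurrence. *)
Definition band (K : numFieldType) (F : nat -> {poly K}) (m : nat)
    (u : nat -> {poly K}) : Prop :=
  exists a : nat -> nat -> K,
    forall n, u n = \sum_(i < m) a i n *: back F n i.

Section Band.
Variables (K : numFieldType) (F : nat -> {poly K}).

Lemma eq_band m u v : u =1 v -> band F m u -> band F m v.
Proof. by move=> uv [a ua]; exists a => n; rewrite -uv. Qed.

Lemma band0 m : band F m (fun=> 0).
Proof.
by exists (fun _ _ => 0) => n; rewrite big1 // => i _; rewrite scale0r.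
Qed.

Lemma band_self : band F 1 F.
Proof.
by exists (fun _ _ => 1) => n; rewrite big_ord1 /back subn0 scale1r.
Qed.

Lemma bandZ m (s : nat -> K) u : band F m u -> band F m (fun n => s n *: u n).
Proof.
move=> [a ua]; exists (fun i n => s n * a i n) => n.
by rewrite ua scaler_sumr; apply: eq_bigr => i _; rewrite scalerA.
Qed.

Lemma bandD m u v : band F m u -> band F m v -> band F m (fun n => u n + v n).
Proof.
move=> [a ua] [b vb]; exists (fun i n => a i n + b i n) => n.
by rewrite ua vb -big_split; apply: eq_bigr => i _; rewrite scalerDl.
Qed.

Lemma bandB m u v : band F m u -> band F m v -> band F m (fun n => u n - v n).
Proof.
move=> bu /(bandZ (fun=> -1)) bv; apply: eq_band (bandD bu bv) => n.
by rewrite scaleN1r.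
Qed.

Lemma band_sum m k (u : 'I_k -> nat -> {poly K}) :
  (forall j, band F m (u j)) -> band F m (fun n => \sum_(j < k) u j n).
Proof.
elim: k u => [|k IH] u bu.
  by apply: eq_band (band0 m) => n; rewrite big_ord0.
apply: eq_band (bandD (bu ord0) (IH _ (fun j => bu (lift ord0 j)))) => n.
by rewrite big_ord_recl.
Qed.

Lemma band_widen m m' u : (m <= m')%N -> band F m u -> band F m' u.
Proof.
move=> mm' [a ua]; exists (fun i n => if (i < m)%N then a i n else 0) => n.
rewrite ua (big_ord_widen m' (fun i => a i n *: back F n i) mm') big_mkcond.
by apply: eq_bigr => i _; case: ifP => // _; rewrite scale0r.
Qed.

Lemma band_back m u : band F m u -> band F m.+1 (fun n => back u n 1).
Proof.
move=> [a ua]; exists (fun i n => if i is i'.+1 then a i' n.-1 else 0) => n.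
rewrite big_ord_recl scale0r add0r /back.
case: n => [|n] /=.
  by rewrite big1 // => i _; rewrite scaler0.
rewrite subn1 ua; apply: eq_bigr => i _.
by rewrite /back /bump /= add1n ltnS subSS.
Qed.

End Band.

(** The j-th power of q^k in c(q^k) is a j-fold dilation of G, and each dilation
    widens the band by one; so a monomial of degree j costs j + 1 terms. *)
Lemma band_conv_horner (K : numFieldType) (q y : K) (E : nat -> K)
    (G : nat -> {poly K}) (c : {poly K}) (m : nat) :
  (forall k, (1 - q ^+ k.+1) * E k.+1 = - (y * q ^+ k) * E k) ->
  (size c <= m)%N ->
  band (conv E G) m (conv E (fun k => c.[q ^+ k] *: G k)).
Proof.
move=> hE cm.
have dil j : band (conv E G) j.+1 (conv E (fun k => q ^+ (j * k) *: G k)).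
  elim: j => [|j IH].
    apply: eq_band (band_self _) => n; apply: eq_conv => k.
    by rewrite mul0n scale1r.
  have b1 := bandZ (fun n => q ^+ n) IH.
  have b2 := bandZ (fun n => y * q ^+ n.-1) (band_back IH).
  apply: eq_band (bandB (band_widen (leqnSn _) b1) b2) => n.
  rewrite -(conv_dilate _ hE); apply: eq_conv => k.
  by rewrite scalerA -exprD mulSn.
suff : band (conv E G) m (fun n =>
    \sum_(j < m) c`_j *: conv E (fun k => q ^+ (j * k) *: G k) n).
  apply: eq_band => n; under eq_bigr do rewrite -mul_polyC -convM.
  rewrite -conv_sum; apply: eq_conv => k.
  rewrite (horner_coef_wide _ cm) scaler_suml; apply: eq_bigr => j _.
  by rewrite mul_polyC scalerA -exprM mulnC.
apply: band_sum => j; apply: bandZ.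
exact: band_widen (ltn_ord j) (dil j).
Qed.

(** * Transport of the recurrence from G to E G *)

(** The sequence (1 - q^k) G_k has generating function G(t) - G(q t), and
    [conv_dilate] compares its product by E with F(t) - F(q t), where F = E G:
    the difference is y t F(q t), which contributes one multiple of F_n.
    The term in e carries a factor t, which is why e must be of smaller size
    than the band. *)
Lemma conv_recurrence (K : numFieldType) (q y : K) (E : nat -> K)
    (G : nat -> {poly K}) (g c e : {poly K}) (m : nat) :
  (forall k, (1 - q ^+ k.+1) * E k.+1 = - (y * q ^+ k) * E k) ->
  (forall k, (1 - q ^+ k.+1) *: G k.+1 =
     g * G k - c.[q ^+ k] *: G k - e.[q ^+ k] *: back G k 1) ->
  (size c <= m)%N -> (size e < m)%N ->
  exists2 u, band (conv E G) m u &
    forall n, (1 - q ^+ n.+1) *: conv E G n.+1 = g * conv E G n - u n.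
Proof.
move=> hE hG cm em.
(* Pulling the shift out of e(q^k) G_(k-1) replaces e(z) by e(q z). *)
pose e' := \poly_(i < m.-1) (e`_i * q ^+ i).
have em' : (size e <= m.-1)%N by rewrite -ltnS (ltn_predK em).
have e'E k : e'.[q ^+ k] = e.[q ^+ k.+1].
  rewrite horner_poly (horner_coef_wide _ em'); apply: eq_bigr => i _.
  by rewrite -mulrA exprS exprMn.
exists (fun n => conv E (fun k => c.[q ^+ k] *: G k) n
   + back (conv E (fun k => e'.[q ^+ k] *: G k)) n 1
   + (y * q ^+ n) *: conv E G n).
  have m0 := leq_ltn_trans (leq0n _) em.
  apply: bandD; first apply: bandD.
  - exact: band_conv_horner hE cm.
  - rewrite -(ltn_predK em); apply: band_back.
    exact: band_conv_horner hE (size_poly _ _).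
  - apply: bandZ; exact: band_widen m0 (band_self _).
move=> n.
have := conv_dilate G hE n.+1; rewrite /back /= subn1 /= => dilE.
have -> : (1 - q ^+ n.+1) *: conv E G n.+1 =
    conv E (fun k => G k - q ^+ k *: G k) n.+1 - (y * q ^+ n) *: conv E G n.
  by rewrite convB dilE scalerBl scale1r opprB addrA addrAC addrK.
rewrite opprD addrA; congr (_ - _).
have -> : conv E (fun k => G k - q ^+ k *: G k) n.+1 =
    conv E (fun k => (1 - q ^+ k.+1) *: G k.+1) n.
  rewrite /conv big_ord_recr /= subnn expr0 scale1r subrr scaler0 addr0.
  apply: eq_bigr => i _.
  by rewrite subSn ?scalerBl ?scale1r // -ltnS ltn_ord.
rewrite (eq_conv _ hG) !convB convM opprD addrA; congr (_ - _).
rewrite -[RHS]/(back (conv E (fun k => e'.[q ^+ k] *: G k)) n 1) -conv_back.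
apply: eq_conv => -[|k]; rewrite /back /=.
  by rewrite scaler0.
by rewrite subn1 e'E.
Qed.

Lemma qpoch_neq0 (K : numFieldType) (q : K) n :
  (forall k, 1 - q ^+ k.+1 != 0) -> qpoch q q n != 0.
Proof.
by move=> q1; apply/prodf_neq0 => i _; rewrite -exprS.
Qed.

Lemma qpochS (K : numFieldType) (q : K) n :
  qpoch q q n.+1 = qpoch q q n * (1 - q ^+ n.+1).
Proof. by rewrite /qpoch big_ord_recr /= exprS. Qed.

(** Dividing by (q)_k turns lambda_k into lambda_k/(1 - q^k), since
    (q)_k = (1 - q^k) (q)_(k-1); this is why the hypothesis of the theorem bears
    on that quotient.  At k = 0 the term vanishes with p_(-1). *)
Lemma qgenfun_recurrence (K : numFieldType) (q : K) (g c e : {poly K})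
    (b lam : nat -> K) (p : nat -> {poly K}) :
  (forall k, 1 - q ^+ k.+1 != 0) ->
  (forall n, p n.+1 = (g - (b n)%:P) * p n - lam n *: back p n 1) ->
  (forall k, b k = c.[q ^+ k]) ->
  (forall k, (0 < k)%N -> lam k / (1 - q ^+ k) = e.[q ^+ k]) ->
  let G := qgenfun q p in
  forall k, (1 - q ^+ k.+1) *: G k.+1 =
     g * G k - c.[q ^+ k] *: G k - e.[q ^+ k] *: back G k 1.
Proof.
move=> q1 hp hb he /= k; rewrite /qgenfun qpochS scalerA.
rewrite invfM mulrCA divff // mulr1 hp scalerBr mulrBl scalerBr mul_polyC hb.
congr (_ - _ - _); [by rewrite scalerAr|by rewrite !scalerA mulrC|].
case: k => [|k]; rewrite /back /= ?scaler0 ?scaler0 // subn1 /= -he // qpochS.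
by rewrite !scalerA; congr (_ *: _); field; rewrite q1 qpoch_neq0.
Qed.

(** When c and e both vanish the maximum is -oo, which no natural number d
    equals. *)
Lemma degree_bounds (K : numFieldType) (c e : {poly K}) (d : nat) :
  (d%:Z)%:E = maxe (degree c + 2%:E)%E (degree e + 3%:E)%E ->
  [/\ (2 <= d)%N, (size c <= d.-1)%N & (size e < d.-1)%N].
Proof.
move=> hd.
have cd : (degree c + 2%:E <= (d%:Z)%:E)%E by rewrite hd le_max lexx.
have ed : (degree e + 3%:E <= (d%:Z)%:E)%E by rewrite hd le_max lexx orbT.
move: hd cd ed; rewrite /degree.
have [->|] := eqVneq c 0; have [->|] := eqVneq e 0;
  rewrite -?size_poly_gt0 ?size_poly0 ?addNye ?maxxx -?EFinD ?lee_fin //;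
  by move=> *; split; lia.
Qed.

Theorem theorem3p1 (R : realType) (q : R[i]) (hq : 0 < `|q| < 1)
  (A : R[i]) (hA : A \is Num.real) (b lam : nat -> R[i])
  (p : nat -> {poly R[i]}) (hp0 : p 0%N = 1)
  (hp : forall n, p n.+1 = (A *: 'X - (b n)%:P) * p n - lam n *: back p n 1)
  (r s : \bar int)
  (hb : poly_in_qpow q 0 b r)
  (hlam : poly_in_qpow q 1 (fun k => lam k / (1 - q ^+ k)) s)
  (P : R[i] -> nat -> {poly R[i]})
  (hP : forall y n, qgenfun q (P y) n =
          fps_mul (fun k => (qpoch_inf q y k)%:P) (qgenfun q p) n)
  (d : nat) (hd : (d%:Z)%:E = maxe (r + 2%:E)%E (s + 3%:E)%E) :
  dterm_recurrence d P.
Proof.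
have [c cr hc] := hb; have [e es he] := hlam.
move: hd; rewrite -cr -es => /degree_bounds[d2 cd ed].
have /andP[_ q_lt1] := hq.
have q1 k : 1 - q ^+ k.+1 != 0.
  apply/eqP => /eqP; rewrite subr_eq0 => /eqP /(congr1 Num.norm)/eqP.
  by rewrite normr1 normrX eq_sym lt_eqF // exprn_ilt1.
have hG := qgenfun_recurrence q1 hp (fun k => hc k isT) he.
split=> //; exists A => //.
suff /choice[a ha] : forall y, exists a : nat -> nat -> R[i], forall n,
    P y n.+1 = (A *: 'X - (a 0 n)%:P) * P y n
               - \sum_(1 <= j < d.-1) a j n *: back (P y) n j.
  by exists a => y n; exact: ha.
move=> y.
have hE := qpoch_inf_step y (complex_cvg_expr q_lt1) q1.
have [u [a ua] hF] := conv_recurrence hE hG cd ed.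
set F := conv _ _ in ua hF.
have PE n : P y n = qpoch q q n *: F n.
  rewrite /F -fps_mul_conv -hP /qgenfun scalerA divff ?scale1r //.
  exact: qpoch_neq0.
exists (fun j n => qpoch q q n * a j n * (qpoch q q (n - j))^-1) => n.
rewrite PE qpochS -scalerA hF ua scalerBr scalerAr -PE mulrBl -addrA -opprD.
congr (_ - _).
have backE i : back F n i = (qpoch q q (n - i))^-1 *: back (P y) n i.
  rewrite /back; case: ifP => _; last by rewrite scaler0.
  by rewrite PE scalerA mulVf ?scale1r // qpoch_neq0.
rewrite scaler_sumr.
rewrite -(big_mkord xpredT (fun i => qpoch q q n *: (a i n *: back F n i))).
rewrite big_ltn; last exact: leq_ltn_trans ed.
congr (_ + _).
  by rewrite mul_polyC backE !scalerA /back /= subn0.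
by apply: eq_bigr => i _; rewrite backE !scalerA.
Qed.
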